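(* Let $\beta=(\beta_k)_{k\ge0}$ be a sequence of positive real numbers with $\beta_1\le\beta_2\le\cdots$, and let $\phi:[0,\infty)\to[0,\infty)$ be a non-decreasing function with $\phi(0)=0$ and $\phi(t)>0$ for $t>0$. Assume that the function $t\mapsto t/\phi(t)$ is monotone on $(0,\infty)$. Then there is a constant $c>0$, depending only on $\phi$ and $\beta$, such that for every integer $M\ge1$, every set of points $\mathbf{x}_1,\dots,\mathbf{x}_N\in\mathbb{S}^2$ with positive weights $w_1,\dots,w_N$ satisfying $\sum_{i=1}^N w_i p(\mathbf{x}_i)=\int_{\mathbb{S}^2}p\,d\omega$ for all $p\in\mathbb{P}_{2M}$, every $\alpha>0$, every filter function $h$, and every $y\in C(\mathbb{S}^2)\cap W^{\phi,\beta}$, $$\left\|(T_{0,M}-T_{\alpha,M}^{\beta})V_My\right\|_{C(\mathbb{S}^2)}\leq cM\hat{\phi}(\alpha)\left\|y\right\|_{W^{\phi,\beta}},$$ where $\hat{\phi}(\alpha)=\phi(\alpha)$ if $t/\phi(t)$ is non-decreasing, and $\hat{\phi}(\alpha)=\alpha$ if $t/\phi(t)$ is non-increasing.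
   Context: $\mathbb{S}^2$ is the unit sphere in $\mathbb{R}^3$ and $d\omega$ is its surface area measure (total mass $4\pi$). $\mathbb{P}_M$ is the set of spherical polynomials of degree $\le M$, i.e. restrictions to $\mathbb{S}^2$ of real polynomials in three variables of degree $\le M$. $\{Y_{k,j}: k\ge 0,\ j=1,\dots,2k+1\}$ is a real spherical harmonic basis ($Y_{k,j}$ of exact degree $k$), orthonormal with respect to $\langle f,g\rangle_{L^2(\mathbb{S}^2)}=\int_{\mathbb{S}^2}fg\,d\omega$. $\|\cdot\|_{C(\mathbb{S}^2)}$ is the supremum norm on $C(\mathbb{S}^2)$. Smoothness space: $$W^{\phi,\beta}=\Bigl\{g\in L^2(\mathbb{S}^2):\ \|g\|_{W^{\phi,\beta}}^2:=\sum_{k=0}^\infty\sum_{j=1}^{2k+1}\frac{|\langle Y_{k,j},g\rangle_{L^2(\mathbb{S}^2)}|^2}{\phi^2(\beta_k^{-2})}<\infty\Bigr\}.$$ A filter function is a function $h:[0,\infty)\to[0,1]$ with $h(t)=1$ for $t\in[0,1/2]$ and $h(t)=0$ for $t>1$. The filtered approximation is $$V_My(\mathbf{x})=\sum_{k=0}^M h\left(\tfrac{k}{M}\right)\sum_{j=1}^{2k+1}Y_{k,j}(\mathbf{x})\langle Y_{k,j},y\rangle_{L^2(\mathbb{S}^2)}.$$ For $g\in C(\mathbb{S}^2)$, $$T_{\alpha,M}^\beta g(\mathbf{x})=\sum_{k=0}^M\sum_{j=1}^{2k+1}\frac{Y_{k,j}(\mathbf{x})}{1+\alpha\beta_k^2}\sum_{i=1}^N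 w_iY_{k,j}(\mathbf{x}_i)g(\mathbf{x}_i),\qquad T_{0,M}g(\mathbf{x})=\sum_{k=0}^M\sum_{j=1}^{2k+1}Y_{k,j}(\mathbf{x})\sum_{i=1}^N w_iY_{k,j}(\mathbf{x}_i)g(\mathbf{x}_i).$$ *)

(* Defs.v *)
From mathcomp Require Import all_boot all_order all_algebra.
From mathcomp Require Import all_classical all_reals all_analysis.
(* The notations of mpoly clash with those of all_analysis. *)
From mathcomp Require Import -(notations) mpoly.

Set Implicit Arguments.
Unset Strict Implicit.
Unset Printing Implicit Defensive.

Import Order.TTheory GRing.Theory Num.Theory.
Import numFieldNormedType.Exports.

Local Open Scope classical_set_scope.
Local Open Scope ring_scope.

Section Sphere.
Context {R : realType}.

(* Functions on the sphere are total functions on R^3; only their values on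
   [sphere] are ever used. The Euclidean norm is spelled out because the
   library norm on row vectors is the maximum norm. *)
Definition sphere : set 'rV[R]_3 := [set x : 'rV[R]_3 | \sum_(i < 3) x 0 i ^+ 2 = 1].

Definition sph_coord (a : R * R) : 'rV[R]_3 :=
  \row_(i < 3) [:: sin a.1 * cos a.2; sin a.1 * sin a.2; cos a.1]`_i.

Definition angles : set (measurableTypeR R * measurableTypeR R) := `[0, pi] `*` `[0, pi *+ 2].

Local Notation angle_measure :=
  ((@lebesgue_measure R) \x (@lebesgue_measure R))%E.

(* The surface integral over the sphere: sin a.1 is the area element
   |d_1 sph_coord x d_2 sph_coord| of the parametrization. *)
Definition sphere_integral (f : 'rV[R]_3 -> R) : R :=
  \int[angle_measure]_(a in angles) (f (sph_coord a) * sin a.1).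

Definition inner (f g : 'rV[R]_3 -> R) : R :=
  sphere_integral (fun x => f x * g x).

(* Measurability on the sphere is measurability in spherical coordinates. *)
Definition in_L2 (f : 'rV[R]_3 -> R) : Prop :=
  measurable_fun angles (f \o sph_coord) /\
  (\int[angle_measure]_(a in angles)
     (f (sph_coord a) ^+ 2 * sin a.1)%:E < +oo)%E.

Definition sup_norm (f : 'rV[R]_3 -> R) : \bar R :=
  ereal_sup [set (`|f x|)%:E | x in sphere].

Definition eval3 (p : mpoly 3 R) (x : 'rV[R]_3) : R :=
  meval (fun i => x 0 i) p.

(* [msize] is 1 + the total degree, and 0 for the zero polynomial. *)
Definition deg_le (M : nat) (p : mpoly 3 R) : Prop :=
  (msize p <= M.+1)%N.

Definition spherical_poly (M : nat) (f : 'rV[R]_3 -> R) : Prop :=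
  exists2 p : mpoly 3 R, deg_le M p & {in sphere, f =1 eval3 p}.

Definition laplacian (p : mpoly 3 R) : mpoly 3 R :=
  \sum_(i < 3) mderiv i (mderiv i p).

Definition spherical_harmonic (k : nat) (f : 'rV[R]_3 -> R) : Prop :=
  exists p : mpoly 3 R,
    [/\ p \is ishomog1 k mdeg, laplacian p = 0
      & {in sphere, f =1 eval3 p}].

(* The index j = 1, ..., 2k+1 is shifted to 0, ..., 2k. *)
Definition harmonic_family := forall k : nat, 'I_(k.*2.+1) -> 'rV[R]_3 -> R.

Definition harmonic_basis (Y : harmonic_family) : Prop :=
  [/\ forall k j, spherical_harmonic k (Y k j),
      forall k j l m, inner (Y k j) (Y l m) =
        ((k == l) && (j == m :> nat))%:R
    & forall k f, spherical_harmonic k f ->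
        exists a : 'I_(k.*2.+1) -> R,
          {in sphere, forall x, f x = \sum_j a j * Y k j x}].

Definition W_norm_sq (phi : R -> R) (beta : nat -> R) (Y : harmonic_family)
    (g : 'rV[R]_3 -> R) : \bar R :=
  (\sum_(0 <= k <oo) (\sum_(j < k.*2.+1)
     `|inner (Y k j) g| ^+ 2 / phi (beta k ^- 2) ^+ 2)%:E)%E.

Definition in_W (phi : R -> R) (beta : nat -> R) (Y : harmonic_family)
    (g : 'rV[R]_3 -> R) : Prop :=
  in_L2 g /\ (W_norm_sq phi beta Y g < +oo)%E.

(* Only meaningful for [g] such that [in_W phi beta Y g]. *)
Definition W_norm (phi : R -> R) (beta : nat -> R) (Y : harmonic_family)
    (g : 'rV[R]_3 -> R) : R :=
  Num.sqrt (fine (W_norm_sq phi beta Y g)).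

Definition filter_function (h : R -> R) : Prop :=
  [/\ forall t : R, 0 <= t -> 0 <= h t <= 1,
      forall t : R, 0 <= t <= 2^-1 -> h t = 1
    & forall t : R, 1 < t -> h t = 0].

Definition filtered_approx (Y : harmonic_family) (h : R -> R) (M : nat)
    (y : 'rV[R]_3 -> R) (x : 'rV[R]_3) : R :=
  \sum_(0 <= k < M.+1) h (k%:R / M%:R) *
    \sum_(j < k.*2.+1) Y k j x * inner (Y k j) y.

Definition quadrature_exact (M N : nat) (xs : 'I_N -> 'rV[R]_3)
    (w : 'I_N -> R) : Prop :=
  forall p, spherical_poly M p ->
    \sum_(i < N) w i * p (xs i) = sphere_integral p.

Definition T_reg (Y : harmonic_family) (beta : nat -> R) (alpha : R)
    (M N : nat) (xs : 'I_N -> 'rV[R]_3) (w : 'I_N -> R)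
    (g : 'rV[R]_3 -> R) (x : 'rV[R]_3) : R :=
  \sum_(0 <= k < M.+1) \sum_(j < k.*2.+1)
    Y k j x / (1 + alpha * beta k ^+ 2) *
    \sum_(i < N) w i * Y k j (xs i) * g (xs i).

Definition T_zero (Y : harmonic_family)
    (M N : nat) (xs : 'I_N -> 'rV[R]_3) (w : 'I_N -> R)
    (g : 'rV[R]_3 -> R) (x : 'rV[R]_3) : R :=
  \sum_(0 <= k < M.+1) \sum_(j < k.*2.+1)
    Y k j x * \sum_(i < N) w i * Y k j (xs i) * g (xs i).

Definition ratio_nondecreasing (phi : R -> R) : Prop :=
  {in `]0, +oo[ &, {homo (fun t => t / phi t) : s t / s <= t}}.

Definition ratio_nonincreasing (phi : R -> R) : Prop :=
  {in `]0, +oo[ &, {homo (fun t => t / phi t) : s t /~ s <= t}}.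

(* A relation, because both cases apply when t / phi t is constant. *)
Definition is_phi_hat (phi phihat : R -> R) : Prop :=
  (ratio_nondecreasing phi /\ forall a, 0 < a -> phihat a = phi a) \/
  (ratio_nonincreasing phi /\ forall a, 0 < a -> phihat a = a).

End Sphere.
Arguments harmonic_family : clear implicits.

(* Main.v *)
(** A quadrature rule that is exact in degree [2 M] acts on products of harmonics
    of degree at most [M] as the surface integral, so the orthonormality
    of the [Y k j] passes to the nodes and no integral has to be computed. It
    gives [T_zero - T_reg] applied to [V_M y] as a finite expansion with
    coefficients [h (k/M) * a b^2 / (1 + a b^2) * <Y k j, y>], [b = beta k], and
    by Cauchy-Schwarz it remains to bound the sum of the [Y k j x ^+ 2] and these
    factors.

    Addition theorem: by the harmonic decomposition [p = h + |x|^2 q], the rule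
    (restricted to polynomials of degree at most [2 M]) is determined by its
    value on constants, because it vanishes on harmonics of positive degree; so
    it is invariant under orthogonal substitutions. These act on the [Y k j] by
    orthogonal matrices, so [\sum_j Y k j x ^+ 2] does not depend on the point
    [x] of the sphere, and applying the rule shows that it is
    [(2k + 1) / area]. *)
Require Import Defs.
From mathcomp Require Import all_boot all_order all_algebra.
From mathcomp Require Import all_classical all_reals all_analysis.
From mathcomp Require Import -(notations) mpoly.
From mathcomp Require Import ring lra.
Set Implicit Arguments.
Unset Strict Implicit.
Unset Printing Implicit Defensive.
Import Order.TTheory GRing.Theory Num.Theory.
Import numFieldNormedType.Exports.
Local Open Scope classical_set_scope.
Local Open Scope ring_scope.

Local Notation "d .-homog" := (ishomog1 d mdeg)
  (at level 1, format "d .-homog") : form_scope.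
Local Notation "''X_' i" := (mpolyX _ (mnm1 i))
  (at level 8, i at level 2, format "''X_' i") : ring_scope.

(** * Harmonic polynomials and orthogonal substitutions *)

Section Harmonic.
Context {n : nat} {F : numFieldType}.
Implicit Types (p q h : mpoly n F) (U : 'M[F]_n).

Definition lap p : mpoly n F := \sum_(i < n) mderiv i (mderiv i p).

Definition sqnorm : mpoly n F := \sum_(i < n) 'X_i ^+ 2.

(** The forms are the coordinates of [x *m U], so substituting them in [p] composes [p] with right
    multiplication by [U]. *)
Definition lin_forms U : n.-tuple (mpoly n F) :=
  [tuple \sum_(j < n) U j i *: 'X_j | i < n].

Local Notation "p \oL U" := (comp_mpoly (lin_forms U) p) (at level 50).

Lemma mpoly_ring_ind (P : mpoly n F -> Prop) :
  (forall c, P (mpolyC n c)) -> (forall i, P 'X_i) ->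
  (forall p q, P p -> P q -> P (p + q)) ->
  (forall p q, P p -> P q -> P (p * q)) ->
  forall p, P p.
Proof.
move=> PC PX PD PM; elim/mpolyind=> [|c m p _ _ Pp].
  by rewrite -(mpolyC0 n); apply: PC.
apply: (PD) => //; rewrite -mul_mpolyC; apply: (PM) => //.
rewrite mpolyXE_id; apply: big_ind => //; first by rewrite -mpolyC1; apply: PC.
move=> i _; elim: (m i) => [|k IHk]; first by rewrite expr0 -mpolyC1; apply: PC.
by rewrite exprS; apply: (PM).
Qed.

Lemma mderiv_XU i j : mderiv i 'X_j = (i == j)%:R :> mpoly n F.
Proof.
rewrite mderivX mnm1E eq_sym; case: eqVneq => [->|_]; last by rewrite scale0r.
rewrite scale1r (_ : mnm_sub _ _ = mnm0) ?mpolyX0 //.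
by apply/mnmP => k; rewrite mnmBE mnm0E subnn.
Qed.

(** The coefficient of [m] in the derivative is a multiple of that of [m + e_i] in [p]. A conclusion
    with [.+1] also excludes [d = 0]. *)
Lemma mdeg_msupp_mderiv i d p m :
  p \is d.-homog -> m \in msupp (mderiv i p) -> (mdeg m).+1 = d.
Proof.
move=> /dhomogP hp; rewrite mcoeff_msupp mcoeff_mderiv => nz.
have /hp : mnm_add m (mnm1 i) \in msupp p.
  by rewrite mcoeff_msupp; apply: contraNneq nz => ->; rewrite mul0rn.
by rewrite /= mdegD mdeg1 addn1.
Qed.

Lemma mderiv_homog i d p : p \is d.-homog -> mderiv i p \is d.-1.-homog.
Proof.
by move=> hp; apply/dhomogP => m /(mdeg_msupp_mderiv hp) /= <-.
Qed.

Lemma mderiv_homog0 i p : p \is 0.-homog -> mderiv i p = 0.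
Proof.
move=> hp; apply/mpolyP => m; rewrite mcoeff0; apply/eqP.
by rewrite mcoeff_eq0; apply/negP => /(mdeg_msupp_mderiv hp).
Qed.

Lemma lap_homog d p : p \is d.-homog -> lap p \is d.-2.-homog.
Proof. by move=> hp; apply: rpred_sum => i _; do 2!apply: mderiv_homog. Qed.

Lemma lap_homog_lt2 d p : (d < 2)%N -> p \is d.-homog -> lap p = 0.
Proof.
move=> d2 hp; apply: big1 => i _; apply/mderiv_homog0.
by have := mderiv_homog i hp; case: d d2 {hp} => [|[]].
Qed.

Lemma sqnorm_homog : sqnorm \is 2.-homog.
Proof.
apply: rpred_sum => i _; rewrite -[2%N]mul1n; apply: dhomogMn.
by rewrite dhomogX /= mdeg1.
Qed.

Lemma homog0_const p : p \is 0.-homog -> exists c, p = mpolyC n c.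
Proof.
move=> hp; exists (mcoeff mnm0 p); apply/mpolyP => m; rewrite mcoeffC.
case: eqVneq => [->|m0]; first by rewrite mulr1.
by rewrite mulr0 (dhomog_nemf_coeff hp) //= mdeg_eq0.
Qed.

Lemma lapD : {morph lap : p q / p + q}.
Proof.
by move=> p q; rewrite -big_split; apply: eq_bigr => i _; rewrite !mderivD.
Qed.

Lemma lapZ c p : lap (c *: p) = c *: lap p.
Proof. by rewrite scaler_sumr; apply: eq_bigr => i _; rewrite !mderivZ. Qed.

Lemma lapB : {morph lap : p q / p - q}.
Proof. by move=> p q; rewrite lapD -scaleN1r lapZ scaleN1r. Qed.

(** * Euler's identity and the harmonic decomposition *)

Lemma euler_homog d p : p \is d.-homog ->
  \sum_(i < n) 'X_i * mderiv i p = p *+ d.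
Proof.
move=> /dhomogP hp; rewrite [in LHS](mpolyE p).
under eq_bigr => i _ do rewrite linear_sum mulr_sumr /=.
rewrite exchange_big [in RHS](mpolyE p) -sumrMnl big_seq [RHS]big_seq.
apply: eq_bigr => m /hp /= <-.
under eq_bigr => i _ do rewrite mderivZ mderivX.
rewrite mdegE -sumrMnr; apply: eq_bigr => i _.
(* If [m i] is 0, the subtraction in [m - e_i] truncates, but the coefficient vanishes. *)
have [mi0|mi] := posnP (m i); first by rewrite mi0 scale0r scaler0 mulr0 mulr0n.
rewrite -!scalerAr -mpolyXD scaler_nat -scalerMnr; congr (_ *: mpolyX _ _ *+ _).
apply/mnmP => k; rewrite mnmDE mnmBE mnm1E.
by case: eqVneq => [<-|_]; rewrite ?subn0 // subnKC.
Qed.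

Lemma mderiv_sqnorm i : mderiv i sqnorm = 'X_i *+ 2.
Proof.
rewrite /sqnorm linear_sum /= (bigD1 i) //= big1 => [|j ji].
  by rewrite expr2 mderivM mderiv_XU eqxx mul1r mulr1 addr0.
by rewrite expr2 mderivM mderiv_XU eq_sym (negPf ji) mul0r mulr0 addr0.
Qed.

(** The product rule leaves the cross term [4 \sum_i x_i d_i q], which Euler's identity turns into
    [4 d q]. *)
Lemma lap_sqnormM d q : q \is d.-homog ->
  lap (sqnorm * q) = sqnorm * lap q + (4 * d + 2 * n)%:R *: q.
Proof.
move=> hq; have step i : mderiv i (mderiv i (sqnorm * q)) =
    sqnorm * mderiv i (mderiv i q) + (('X_i * mderiv i q) *+ 4 + q *+ 2).
  rewrite mderivM mderivD !mderivM !mderiv_sqnorm mderivMn mderiv_XU eqxx.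
  by rewrite /=; ring.
rewrite /lap (eq_bigr _ (fun i _ => step i)) !big_split -mulr_sumr /=.
rewrite (euler_homog hq) sumr_const card_ord scaler_nat -!mulrnDr.
by congr (_ + _ *+ _); ring.
Qed.

(* The shift by [c] makes the induction go through: on [h + |x|^2 q] with [h]
   harmonic, [lap (|x|^2 _) + c] acts as a positive scalar on [h] and as an
   operator of the same shape on [q]. *)
Lemma lap_sqnorm_surj (c : F) d q : (0 < n)%N -> 0 <= c -> q \is d.-homog ->
  exists2 u, u \is d.-homog & lap (sqnorm * u) + c *: u = q.
Proof.
move=> n0; elim/ltn_ind: d c q => d IHd c q c0 hq.
set e : F := (4 * d + 2 * n)%:R.
have e0 : e + c != 0.
  by rewrite gt_eqF // ltr_wpDr // ltr0n addn_gt0 !muln_gt0 n0 orbT.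
have harm h : h \is d.-homog -> lap h = 0 ->
    lap (sqnorm * ((e + c)^-1 *: h)) + c *: ((e + c)^-1 *: h) = h.
  move=> hh lh; rewrite (@lap_sqnormM d) ?rpredZ // lapZ lh scaler0 mulr0 add0r.
  by rewrite -scalerDl scalerA divff // scale1r.
have [d2|d2] := ltnP d 2.
  exists ((e + c)^-1 *: q); first exact: rpredZ.
  by apply: harm => //; apply: lap_homog_lt2 hq.
have dE : (2 + d.-2 = d)%N by rewrite -subn2 subnKC.
have lt_d : (d.-2 < d)%N by rewrite -[ltnRHS]dE.
(* This choice makes [q - sqnorm * q'] harmonic, so [harm] treats it and only [sqnorm * q'] is
   left. *)
have [q' hq' lq'] := IHd _ lt_d 0 _ (lexx _) (lap_homog hq).
rewrite scale0r addr0 in lq'.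
have hr v : v \is d.-2.-homog -> sqnorm * v \is d.-homog.
  by move=> hv; rewrite -[d]dE; apply: dhomogM hv; apply: sqnorm_homog.
(* On [sqnorm * v] the operator is [sqnorm] times [lap (sqnorm * v) + (e + c) *: v], hence the new
   shift. *)
have [v hv lv] := IHd _ lt_d (e + c) _ (addr_ge0 (ler0n _ _) c0) hq'.
have hh : q - sqnorm * q' \is d.-homog by rewrite rpredB ?hr.
have lh : lap (q - sqnorm * q') = 0 by rewrite lapB lq' subrr.
have := harm _ hh lh; set u := _ *: (q - _) => lu.
exists (u + sqnorm * v); first by rewrite rpredD ?rpredZ ?hr.
rewrite mulrDr lapD scalerDr addrACA lu (lap_sqnormM (hr _ hv)) -/e.
by rewrite -[X in _ + X]addrA -scalerDl scalerAr -mulrDr lv subrK.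
Qed.

(** Solving [lap (sqnorm * q) = lap p] for [q] makes the remainder harmonic. *)
Lemma harmonic_decomposition d p : (0 < n)%N -> p \is d.+2.-homog ->
  exists h q, [/\ h \is d.+2.-homog, lap h = 0, q \is d.-homog
                & p = h + sqnorm * q].
Proof.
move=> n0 hp.
have [q hq lq] := lap_sqnorm_surj n0 (lexx 0) (lap_homog hp).
exists (p - sqnorm * q), q; split=> //.
- by rewrite rpredB // -[d.+2]add2n dhomogM // sqnorm_homog.
- by rewrite lapB -lq scale0r addr0 subrr.
- by rewrite subrK.
Qed.

(** * Linear and orthogonal substitutions *)

Lemma tnth_lin_forms U i : tnth (lin_forms U) i = \sum_(j < n) U j i *: 'X_j.
Proof. by rewrite tnth_mktuple. Qed.

Lemma comp_lin_XU U i : 'X_i \oL U = \sum_(j < n) U j i *: 'X_j.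
Proof. by rewrite comp_mpolyXU -tnth_nth tnth_lin_forms. Qed.

Lemma comp_lin_homog U d p : p \is d.-homog -> p \oL U \is d.-homog.
Proof.
move=> /dhomogP hp; rewrite comp_mpolyEX big_seq.
apply: rpred_sum => m /hp /= <-; apply: rpredZ; rewrite comp_mpolyX mdegE.
apply: (big_ind2 (fun (q : mpoly n F) k => q \is k.-homog)) => [|*|i _].
- exact: dhomog1.
- exact: dhomogM.
rewrite -[X in ishomog1 X _]mul1n; apply: dhomogMn; rewrite tnth_lin_forms.
by apply: rpred_sum => j _; rewrite rpredZ // dhomogX /= mdeg1.
Qed.

Lemma mderiv_comp_lin U k p :
  mderiv k (p \oL U) = \sum_(i < n) U k i *: (mderiv i p \oL U).
Proof.
elim/mpoly_ring_ind: p => [c|i|p q IHp IHq|p q IHp IHq].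
- rewrite comp_mpolyC mderivC big1 // => i _.
  by rewrite mderivC comp_mpoly0 scaler0.
- rewrite comp_lin_XU linear_sum /= (bigD1 k) //= big1 ?addr0; last first.
    by move=> j jk; rewrite mderivZ mderiv_XU eq_sym (negPf jk) scaler0.
  rewrite (bigD1 i) //= big1 ?addr0; last first.
    by move=> j ji; rewrite mderiv_XU (negPf ji) comp_mpoly0 scaler0.
  by rewrite mderivZ !mderiv_XU !eqxx comp_mpoly1.
- rewrite comp_mpolyD mderivD IHp IHq -big_split; apply: eq_bigr => i _ /=.
  by rewrite mderivD comp_mpolyD scalerDr.
rewrite rmorphM mderivM IHp IHq mulr_suml mulr_sumr -big_split /=.
apply: eq_bigr => i _; rewrite mderivM comp_mpolyD !rmorphM scalerDr /=.
by rewrite scalerAl scalerAr.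
Qed.

(** The chain rule, applied twice, gives the second derivatives the entries of [U^T *m U] as
    coefficients, so only the pure ones survive. *)
Lemma lap_comp_lin U p : U^T *m U = 1%:M -> lap (p \oL U) = lap p \oL U.
Proof.
move=> UU; have row i l : \sum_k U k i * U k l = (i == l)%:R.
  have := congr1 (fun A : 'M[F]_n => A i l) UU; rewrite !mxE => <-.
  by apply: eq_bigr => k _; rewrite mxE.
rewrite /lap linear_sum /=.
under eq_bigr => k _ do rewrite mderiv_comp_lin linear_sum /=.
rewrite exchange_big; apply: eq_bigr => i _ /=.
under eq_bigr => k _ do rewrite mderivZ mderiv_comp_lin scaler_sumr.
rewrite exchange_big (bigD1 i) //= [X in _ + X]big1 => [|l li].
  under eq_bigr => k _ do rewrite scalerA.
  by rewrite -scaler_suml row eqxx scale1r addr0.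
under eq_bigr => k _ do rewrite scalerA.
by rewrite -scaler_suml row eq_sym (negPf li) scale0r.
Qed.

Lemma meval_comp_lin U p (x : 'rV[F]_n) :
  meval (fun i => x 0 i) (p \oL U) = meval (fun i => (x *m U) 0 i) p.
Proof.
rewrite comp_mpoly_meval; apply: meval_eq => i; rewrite tnth_lin_forms.
rewrite linear_sum mxE; apply: eq_bigr => j _ /=.
by rewrite mevalZ mevalXU mulrC.
Qed.

Lemma meval_sqnorm (x : 'I_n -> F) : meval x sqnorm = \sum_i x i ^+ 2.
Proof.
by rewrite linear_sum; apply: eq_bigr => i _ /=; rewrite rmorphXn /= mevalXU.
Qed.

Lemma sqnorm_comp_lin U : U *m U^T = 1%:M -> sqnorm \oL U = sqnorm.
Proof.
move=> UU; have col j l : \sum_i U j i * U l i = (j == l)%:R.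
  have := congr1 (fun A : 'M[F]_n => A j l) UU; rewrite !mxE => <-.
  by apply: eq_bigr => k _; rewrite mxE.
rewrite /sqnorm linear_sum /=.
under eq_bigr => i _ do rewrite rmorphXn /= comp_lin_XU expr2 mulr_suml.
rewrite exchange_big; apply: eq_bigr => j _ /=.
under eq_bigr => i _ do rewrite mulr_sumr.
rewrite exchange_big (bigD1 j) //= [X in _ + X]big1 => [|l lj].
  under eq_bigr => k _ do rewrite -scalerAl -scalerAr scalerA -expr2.
  by rewrite -scaler_suml col eqxx scale1r addr0.
under eq_bigr => k _ do rewrite -scalerAl -scalerAr scalerA.
by rewrite -scaler_suml col eq_sym (negPf lj) scale0r.
Qed.

(* By the harmonic decomposition, the hypotheses determine [L] on each
   homogeneous component up to its value on constants, and they are invariant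
   under orthogonal substitutions. *)
Lemma orthogonal_invariance (V : nmodType) (L : mpoly n F -> V) D U :
  (0 < n)%N ->
  {morph L : p q / p + q} ->
  (forall q, L (sqnorm * q) = L q) ->
  (forall d h, (0 < d <= D)%N -> h \is d.-homog -> lap h = 0 -> L h = 0) ->
  U *m U^T = 1%:M ->
  forall d p, (d <= D)%N -> p \is d.-homog -> L (p \oL U) = L p.
Proof.
move=> n0 LD Lr Lh UU; have UU' := mulmx1C UU.
(* The substitution preserves harmonicity, so both sides are 0 in positive degree; constants are
   fixed. *)
have Lharm d h : (d <= D)%N -> h \is d.-homog -> lap h = 0 -> L (h \oL U) = L h.
  case: d => [_ /homog0_const[c ->] _|d dD hh lh]; first by rewrite comp_mpolyC.
  rewrite !(Lh d.+1) //; first exact: comp_lin_homog.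
  by rewrite lap_comp_lin // lh comp_mpoly0.
elim/ltn_ind=> -[|[|d]] IHd p dD hp.
- by apply: (Lharm _ _ dD hp); apply: lap_homog_lt2 hp.
- by apply: (Lharm _ _ dD hp); apply: lap_homog_lt2 hp.
have [h [q [hh lh hq ->]]] := harmonic_decomposition n0 hp.
rewrite comp_mpolyD rmorphM /= sqnorm_comp_lin // !LD !Lr (Lharm d.+2) //.
by rewrite (IHd d) // ltnW // ltnW.
Qed.

End Harmonic.

(** The Householder reflection in the hyperplane orthogonal to [x - y] exchanges two vectors of
    equal length. *)
Lemma orthogonal_transitive {n} {F : realFieldType} (x y : 'rV[F]_n) :
  x *m x^T = y *m y^T -> exists2 U : 'M[F]_n, U *m U^T = 1%:M & x *m U = y.
Proof.
move=> xy; have [<-|neq_xy] := eqVneq x y.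
  by exists 1%:M; rewrite ?trmx1 mulmx1.
pose v := x - y; pose s := (v *m v^T) 0 0.
have s0 : s != 0.
  apply: contra_neq neq_xy => s0; apply/eqP; rewrite -subr_eq0 -/v.
  apply/eqP/rowP => i; rewrite [RHS]mxE; apply/eqP; rewrite -sqrf_eq0.
  move: s0; rewrite /s mxE => /eqP; rewrite psumr_eq0 => [|j _].
    by move=> /allP /(_ i); rewrite mem_index_enum [v^T _ _]mxE -expr2 /= => ->.
  by rewrite [v^T _ _]mxE -expr2 sqr_ge0.
have vv : v *m v^T = s%:M by rewrite [LHS]mx11_scalar.
(* Here equal lengths enter: the reflection subtracts exactly [v] from [x]. *)
have xv : x *m v^T = (s / 2)%:M.
  suff : x *m v^T *+ 2 = s%:M.
    move=> /(congr1 (fun A => 2^-1 *: A)).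
    rewrite -scalerMnr scalerMnl -mulr_natr mulVf ?pnatr_eq0 // scale1r.
    by rewrite scale_scalar_mx mulrC.
  have tr11 (A : 'M[F]_1) : A^T = A by rewrite [A]mx11_scalar tr_scalar_mx.
  rewrite -vv mulr2n /v linearB /= mulmxBl !mulmxBr -xy.
  by rewrite -[y *m x^T]tr11 trmx_mul trmxK opprB.
exists (1%:M - (2 / s) *: (v^T *m v)); last first.
  rewrite mulmxBr mulmx1 -scalemxAr mulmxA xv mul_scalar_mx scalerA.
  by rewrite mulrA divfK // divff ?pnatr_eq0 // scale1r opprB addrC subrK.
set P := v^T *m v.
have PT : P^T = P by rewrite trmx_mul trmxK.
have PP : P *m P = s *: P 
  by rewrite /P mulmxA -(mulmxA v^T) vv mul_mx_scalar scalemxAl.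
have -> : (1%:M - (2 / s) *: P)^T = 1%:M - (2 / s) *: P.
  by rewrite raddfB /= tr_scalar_mx; congr (_ - _); rewrite linearZ /= PT.
rewrite mulmxBr mulmx1 mulmxBl mul1mx -!(scalemxAl, scalemxAr) PP !scalerA.
rewrite -(mulrA (2 / s)) divfK // mulr_natr mulr2n scalerDl opprB.
by rewrite addrK subrK.
Qed.

Local Notation "p \oL U" := (comp_mpoly (lin_forms U) p) (at level 50).

(** * The addition theorem *)

Section AdditionTheorem.
Context {R : realType}.
Implicit Types (p q h : mpoly 3 R) (x : 'rV[R]_3) (U : 'M[R]_3).

Lemma laplacianE p : laplacian p = lap p.
Proof. by []. Qed.

Lemma sphereE x : sphere x <-> x *m x^T = 1%:M.
Proof.
rewrite [x *m _]mx11_scalar mxE.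
have -> : \sum_j x 0 j * x^T j 0 = \sum_(i < 3) x 0 i ^+ 2.
  by apply: eq_bigr => i _; rewrite mxE expr2.
by split=> [->//|] => /(congr1 (fun A : 'M[R]_1 => A 0 0)); rewrite !mxE.
Qed.

Lemma sphere_orthogonal U x : U *m U^T = 1%:M -> sphere x -> sphere (x *m U).
Proof.
move=> UU /sphereE xx; apply/sphereE.
by rewrite trmx_mul mulmxA -(mulmxA x) UU mulmx1.
Qed.

Lemma homog_deg_le d D p : (d <= D)%N -> p \is d.-homog -> deg_le D p.
Proof.
move=> dD /dhomogP hp; rewrite /deg_le msizeE; apply/bigmax_leqP_seq => m.
by move=> /hp /= -> _; rewrite ltnS.
Qed.

(** * The quadrature rule on harmonics *)

Context (Y : harmonic_family R) (hY : harmonic_basis Y).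
Arguments Y : clear implicits.
Context (M N : nat) (xs : 'I_N -> 'rV[R]_3) (w : 'I_N -> R).
Hypotheses (xsS : forall i, sphere (xs i))
  (quad : quadrature_exact (2 * M) xs w).

Definition area : R := sphere_integral (fun _ : 'rV[R]_3 => 1).

Let L p := \sum_i w i * eval3 p (xs i).

Lemma quadY k l j m : (k + l <= 2 * M)%N ->
  \sum_i w i * (Y k j (xs i) * Y l m (xs i)) =
  ((k == l) && (j == m :> nat))%:R.
Proof.
case: hY => Yharm <- _ klM; apply: quad.
have [p [hp _ pE]] := Yharm k j; have [q [hq _ qE]] := Yharm l m.
exists (p * q); first exact: homog_deg_le klM (dhomogM hp hq).
by move=> x xS; rewrite pE // qE // /eval3 mevalM.
Qed.

Lemma sum_weights : \sum_i w i = area.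
Proof.
rewrite /area -quad; first by apply: eq_bigr => i _; rewrite mulr1.
exists 1; first by apply: homog_deg_le (leq0n _) _; apply: dhomog1.
by move=> x _; rewrite /eval3 meval1.
Qed.

(** This nonzero constant in the basis yields both the positivity of [area] and the vanishing of the
    rule on harmonics of positive degree. *)
Lemma Y0_const :
  exists2 c, {in sphere, forall x, Y 0%N ord0 x = c} & c ^+ 2 * area = 1.
Proof.
have [Yharm _ _] := hY; have [p [/homog0_const[c ->] _ pE]] := Yharm 0%N ord0.
exists c => [x xS|]; first by rewrite pE // /eval3 mevalC.
transitivity (\sum_i w i * (Y 0%N ord0 (xs i) * Y 0%N ord0 (xs i))).
  2: by rewrite quadY.
rewrite -sum_weights mulr_sumr; apply: eq_bigr => i _.
by rewrite pE ?mem_set // /eval3 mevalC; ring.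
Qed.

Lemma area_gt0 : 0 < area.
Proof.
have [c _ cE] := Y0_const; have c0 : c != 0.
  by apply: contra_eq_neq cE => ->; rewrite expr0n mul0r eq_sym oner_neq0.
by rewrite -(pmulr_rgt0 _ (_ : 0 < c ^+ 2)) ?cE // exprn_even_gt0.
Qed.

Lemma quad_harmonic d h : (0 < d <= 2 * M)%N -> h \is d.-homog -> lap h = 0 ->
  L h = 0.
Proof.
move=> /andP[d0 dM] hh lh; have [c cE cS] := Y0_const.
have [_ _ Yspan] := hY.
have [|a aE] := Yspan d (eval3 h); first by exists h.
have c0 : c != 0.
  by apply: contra_eq_neq cS => ->; rewrite expr0n mul0r eq_sym oner_neq0.
(* Multiplying by [c], the value of [Y 0 0], creates discrete inner products of harmonics of
   distinct degrees. *)
apply: (mulIf c0); rewrite mul0r mulr_suml.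
under eq_bigr => i _ do rewrite aE ?mem_set // mulr_sumr mulr_suml.
rewrite exchange_big big1 // => j _ /=.
transitivity (a j * \sum_i w i * (Y d j (xs i) * Y 0%N ord0 (xs i))).
  by rewrite mulr_sumr; apply: eq_bigr => i _; rewrite cE ?mem_set //; ring.
by rewrite quadY ?addn0 // (gtn_eqF d0) mulr0.
Qed.

(** The rule does not see the factor [sqnorm], which is 1 at every node. *)
Lemma quad_invariant U : U *m U^T = 1%:M ->
  forall d p, (d <= 2 * M)%N -> p \is d.-homog -> L (p \oL U) = L p.
Proof.
apply: orthogonal_invariance => // [p q|q|]; last exact: quad_harmonic.
  by rewrite -big_split; apply: eq_bigr => i _ /=; rewrite -mulrDr /eval3 mevalD.
apply: eq_bigr => i _; rewrite /eval3 mevalM meval_sqnorm.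
by rewrite (xsS i) mul1r.
Qed.

Definition Yvec k x : 'cV[R]_(k.*2.+1) := \col_j Y k j x.

(** The transformed harmonics are again harmonic, which gives [A]. By invariance of the rule in
    degree [k + k], the Gram matrix is the identity at the nodes and at their images, which forces
    [A *m A^T] to be 1. *)
Lemma Yvec_orthogonal k U : (k <= M)%N -> U *m U^T = 1%:M ->
  exists2 A : 'M[R]_(k.*2.+1), A *m A^T = 1%:M
    & forall x, sphere x -> Yvec k (x *m U) = A *m Yvec k x.
Proof.
move=> kM UU; have [Yharm _ Yspan] := hY.
have [p pP] := choice (Yharm k).
have /choice[a aE] : forall j, exists a : 'I_(k.*2.+1) -> R,
    forall x, sphere x -> Y k j (x *m U) = \sum_m a m * Y k m x.
  move=> j; have [hp lp pE] := pP j.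
  have [|a aE] := Yspan k (eval3 (p j \oL U)).
    exists (p j \oL U); split=> //; first exact: comp_lin_homog.
    rewrite laplacianE (lap_comp_lin _ (mulmx1C UU)) -laplacianE lp.
    exact: comp_mpoly0.
  exists a => x xS; rewrite -aE ?mem_set // /eval3 meval_comp_lin.
  by rewrite pE // mem_set //; apply: sphere_orthogonal.
have AE x : sphere x -> Yvec k (x *m U) = (\matrix_(j, m) a j m) *m Yvec k x.
  move=> xS; apply/colP => j; rewrite !mxE aE //.
  by apply: eq_bigr => m _; rewrite !mxE.
exists (\matrix_(j, m) a j m) => //.
set A := \matrix_(_, _) _ in AE *.
have gram V : V *m V^T = 1%:M ->
    \sum_i w i *: (Yvec k (xs i *m V) *m (Yvec k (xs i *m V))^T) = 1%:M.
  move=> VV; apply/matrixP => j m.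
  have [[hj _ jE] [hm _ mE]] := (pP j, pP m).
  have LE : L (p j * p m) = (1%:M : 'M[R]_(k.*2.+1)) j m.
    transitivity (\sum_i w i * (Y k j (xs i) * Y k m (xs i))).
      by apply: eq_bigr => i _; rewrite jE ?mE ?mem_set // /eval3 mevalM.
    by rewrite quadY ?mxE ?eqxx // mul2n -addnn leq_add.
  rewrite -LE -(quad_invariant VV (_ : k + k <= _)%N (dhomogM hj hm)); last first.
    by rewrite mul2n -addnn leq_add.
  rewrite summxE; apply: eq_bigr => i _; rewrite !mxE big_ord1 !mxE rmorphM /=.
  have xV : sphere (xs i *m V) by apply: sphere_orthogonal.
  by rewrite jE ?mE ?mem_set // /eval3 mevalM !meval_comp_lin.
have := gram U UU; have := gram 1%:M; rewrite trmx1 mulmx1 => /(_ erefl).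
under eq_bigr => i _ do rewrite mulmx1.
move=> gram1; under eq_bigr => i _ do
  rewrite AE // trmx_mul mulmxA -(mulmxA A) scalemxAl scalemxAr.
by rewrite -mulmx_suml -mulmx_sumr gram1 mulmx1.
Qed.

Lemma Yvec_norm_const k x y : (k <= M)%N -> sphere x -> sphere y ->
  \sum_j Y k j x ^+ 2 = \sum_j Y k j y ^+ 2.
Proof.
move=> kM xS yS; have [] := @orthogonal_transitive 3 R x y.
  by move/sphereE: xS => ->; move/sphereE: yS => ->.
move=> U UU xU; have [A AA AE] := Yvec_orthogonal kM UU.
have normE z : \sum_j Y k j z ^+ 2 = ((Yvec k z)^T *m Yvec k z) 0 0.
  by rewrite !mxE; apply: eq_bigr => j _; rewrite !mxE expr2.
rewrite !normE -xU AE // trmx_mul mulmxA -(mulmxA _ A^T) mulmx1C //.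
by rewrite mulmx1.
Qed.

Lemma addition_theorem k x : (k <= M)%N -> sphere x ->
  \sum_j Y k j x ^+ 2 = k.*2.+1%:R / area.
Proof.
move=> kM xS; have area0 := lt0r_neq0 area_gt0; apply: (mulIf area0).
rewrite divfK // -sum_weights mulr_sumr.
(* At each node the value at [x] is replaced by the value at that node; this leaves [2k + 1]
   discrete squared norms, each equal to 1. *)
transitivity (\sum_i \sum_j w i * (Y k j (xs i) * Y k j (xs i))).
  apply: eq_bigr => i _; rewrite (Yvec_norm_const kM xS (xsS i)) mulrC mulr_sumr.
  by apply: eq_bigr => j _; rewrite expr2.
rewrite exchange_big /= (eq_bigr (fun=> 1)) ?sumr_const ?card_ord // => j _.
by rewrite quadY ?eqxx // mul2n -addnn leq_add.
Qed.
End AdditionTheorem.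

(** * The approximation bound *)

(** For [B] nonzero this follows from [B (A B - C^2) = \sum_i (B a_i - C b_i)^2]. *)
Lemma cauchy_schwarz_sum {R : rcfType} (I : finType) (a b : I -> R) :
  `|\sum_i a i * b i| <= Num.sqrt (\sum_i a i ^+ 2) * Num.sqrt (\sum_i b i ^+ 2).
Proof.
set A := \sum_i a i ^+ 2; set B := \sum_i b i ^+ 2; set C := \sum_i _.
have A0 : 0 <= A by apply: sumr_ge0 => i _; apply: sqr_ge0.
have B0 : 0 <= B by apply: sumr_ge0 => i _; apply: sqr_ge0.
rewrite -sqrtrM // -sqrtr_sqr ler_wsqrtr //.
have [B_eq0|B_neq0] := eqVneq B 0.
  rewrite /C big1 ?expr0n ?mulr_ge0 // => i _.
  move/eqP: B_eq0; rewrite psumr_eq0 => [/allP /(_ i)|j _]; last exact: sqr_ge0.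
  by rewrite mem_index_enum sqrf_eq0 /= => /(_ isT)/eqP ->; rewrite mulr0.
have Bgt0 : 0 < B by rewrite lt_def B_neq0.
rewrite -subr_ge0 -(pmulr_rge0 _ Bgt0).
have -> : B * (A * B - C ^+ 2) = \sum_i (B * a i - C * b i) ^+ 2.
  have sqE i : (B * a i - C * b i) ^+ 2 =
      B ^+ 2 * a i ^+ 2 + (C ^+ 2 * b i ^+ 2 - 2 * B * C * (a i * b i)) by ring.
  rewrite (eq_bigr _ (fun i _ => sqE i)) big_split sumrB -!mulr_sumr /=.
  by rewrite -/A -/B -/C; ring.
by apply: sumr_ge0 => i _; apply: sqr_ge0.
Qed.

(** The range of [j] depends on [k], so the double sum is flattened to one over dependent pairs. *)
Lemma cauchy_schwarz_dep_sum {R : rcfType} n (d : nat -> nat)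
    (a b : forall k, 'I_(d k) -> R) :
  `|\sum_(0 <= k < n) \sum_j a k j * b k j| <=
  Num.sqrt (\sum_(0 <= k < n) \sum_j a k j ^+ 2) *
  Num.sqrt (\sum_(0 <= k < n) \sum_j b k j ^+ 2).
Proof.
by rewrite !big_mkord !sig_big_dep /=; apply: cauchy_schwarz_sum.
Qed.

Section FilterFactor.
Context {R : realType} (phi : R -> R).
Hypotheses (phi_ndecr : {in `[0, +oo[ &, {homo phi : s t / s <= t}})
  (phi_gt0 : forall t : R, 0 < t -> 0 < phi t).

(* [a / (t + a)] is the factor [a b^2 / (1 + a b^2)] at [t = b^-2]. *)
Lemma filter_factor_le (phihat : R -> R) (a t t0 : R) :
  is_phi_hat phi phihat -> 0 < a -> 0 < t <= t0 ->
  a / (t + a) <= (1 + phi t0 / t0) * phihat a / phi t.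
Proof.
move=> hat a0 /andP[tgt0 tt0].
have ta0 : 0 < t + a by rewrite addr_gt0.
have t00 : 0 < t0 by apply: lt_le_trans tt0.
have [[pa pt] p0] := (phi_gt0 a0, phi_gt0 tgt0, phi_gt0 t00).
have in0 (s : R) : 0 < s -> s \in `]0, +oo[.
  by move=> s0; rewrite in_itv /= s0.
have in0c (s : R) : 0 < s -> s \in `[0, +oo[.
  by move=> s0; rewrite in_itv /= ltW.
set r := phi t0 / t0; have r0 : 0 < r by rewrite divr_gt0.
rewrite ler_pdivlMr // [_ / _ * _]mulrAC ler_pdivrMr //.
have pos : 0 <= r * phihat a * (t + a) /\ 0 <= phihat a.
  have h0 : 0 <= phihat a by case: hat => -[_ ->] //; apply: ltW.
  by split=> //; apply: mulr_ge0 (ltW ta0); apply: mulr_ge0 h0; apply: ltW.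
case: hat => -[ratio hatE]; move: pos; rewrite hatE // => -[pos _]; last first.
  (* Non-increasing ratio: comparison with [t0] gives [phi t <= t * r], which the summand [r] of the
     constant absorbs. *)
  have : t0 / phi t0 <= t / phi t. by apply: ratio; rewrite ?in0.
  rewrite ler_pdivrMr // [_ / _ * _]mulrAC ler_pdivlMr // => ratio_t.
  have : phi t <= t * r by rewrite mulrA ler_pdivlMr // mulrC.
  by nra.
(* Non-decreasing ratio: monotonicity of [phi] settles [t <= a], that of the ratio settles [a <= t];
   the summand 1 suffices. *)
have [ta|/ltW at_] := leP t a.
  have : phi t <= phi a by apply: phi_ndecr; rewrite ?in0c //.
  by nra.
have : a / phi a <= t / phi t by apply: ratio; rewrite ?in0 //.
rewrite ler_pdivrMr // [_ / _ * _]mulrAC ler_pdivlMr //.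
by nra.
Qed.
End FilterFactor.

(** * The difference of the two operators as a finite expansion *)

Section Filtered.
Context {R : realType} (Y : harmonic_family R) (hY : harmonic_basis Y).
Arguments Y : clear implicits.
Context (M N : nat) (xs : 'I_N -> 'rV[R]_3) (w : 'I_N -> R).
Hypotheses (xsS : forall i, sphere (xs i))
  (quad : quadrature_exact (2 * M) xs w).
Context (h : R -> R) (y : 'rV[R]_3 -> R).

(** Discrete orthonormality applies to every term, as all degrees are at most [M], and leaves only
    the index [(k, j)]. *)
Lemma quad_filtered_approx k j : (k <= M)%N ->
  \sum_i w i * Y k j (xs i) * filtered_approx Y h M y (xs i) =
  h (k%:R / M%:R) * inner (Y k j) y.
Proof.
move=> kM; transitivity (\sum_(0 <= l < M.+1) h (l%:R / M%:R) *
    \sum_m inner (Y l m) y * \sum_i w i * (Y k j (xs i) * Y l m (xs i))).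
  under eq_bigr => i _ do rewrite mulr_sumr.
  rewrite exchange_big /=; apply: eq_bigr => l _.
  transitivity (\sum_i \sum_m h (l%:R / M%:R) *
      (inner (Y l m) y * (w i * (Y k j (xs i) * Y l m (xs i))))).
    apply: eq_bigr => i _; rewrite mulrA mulr_sumr.
    by apply: eq_bigr => m _; ring.
  rewrite exchange_big mulr_sumr; apply: eq_bigr => m _ /=.
  by rewrite !mulr_sumr.
rewrite big_mkord (bigD1 (Ordinal (kM : (k < M.+1)%N))) //=.
rewrite [X in _ + X]big1 => [|l lk].
  rewrite addr0 (bigD1 j) //= [X in _ * (_ + X)]big1 => [|m mj].
    by rewrite (quadY hY quad) ?eqxx ?mulr1 ?addr0 // mul2n -addnn leq_add.
  rewrite (quadY hY quad); last by rewrite mul2n -addnn leq_add.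
  rewrite [(j == m :> nat)](_ : _ = false) ?andbF ?mulr0 // eq_sym.
  exact/negbTE.
rewrite big1 ?mulr0 // => m _; rewrite (quadY hY quad).
  rewrite (_ : (k == l) = false) ?mulr0 //.
  by apply: contra_neqF lk => /eqP kl; apply: val_inj.
by rewrite mul2n -addnn leq_add // -ltnS.
Qed.

Lemma T_zero_sub_T_reg beta alpha x :
  T_zero Y M xs w (filtered_approx Y h M y) x -
  T_reg Y beta alpha M xs w (filtered_approx Y h M y) x =
  \sum_(0 <= k < M.+1) \sum_j Y k j x *
    (h (k%:R / M%:R) * (1 - (1 + alpha * beta k ^+ 2)^-1) * inner (Y k j) y).
Proof.
rewrite -sumrB; apply: eq_big_nat => k /andP[_ kM].
rewrite -sumrB; apply: eq_bigr => j _.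
by rewrite quad_filtered_approx //; ring.
Qed.
End Filtered.

Lemma W_norm_partial {R : realType} (phi : R -> R) (beta : nat -> R)
    (Y : harmonic_family R) (g : 'rV[R]_3 -> R) (n : nat) : in_W phi beta Y g ->
  Num.sqrt (\sum_(0 <= k < n) \sum_j (inner (Y k j) g / phi (beta k ^- 2)) ^+ 2)
  <= W_norm phi beta Y g.
Proof.
move=> [_ Wfin].
have u0 k :
    0 <= \sum_(j < k.*2.+1) `|inner (Y k j) g| ^+ 2 / phi (beta k ^- 2) ^+ 2.
  by apply: sumr_ge0 => j _; rewrite mulr_ge0 ?invr_ge0 ?sqr_ge0.
have W0 : (0 <= W_norm_sq phi beta Y g)%E.
  by apply: nneseries_ge0 => k _ _; rewrite lee_fin.
(* Since [fine] sends [+oo] to 0, finiteness of the norm is essential here. *)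
rewrite ler_wsqrtr // -lee_fin fineK ?ge0_fin_numE //.
rewrite -sumEFin; under eq_bigr => k _.
  under eq_bigr => j _ do rewrite expr_div_n -(real_normK (num_real (inner _ _))).
  over.
by apply: nneseries_lim_ge => k _ _; rewrite lee_fin; apply: u0.
Qed.

(** The sum of the first [M + 1] odd numbers is [(M + 1)^2]; its square root accounts for the factor
    [M] in the theorem. *)
Lemma sum_odd_le {R : realType} (M : nat) : (1 <= M)%N ->
  \sum_(0 <= k < M.+1) k.*2.+1%:R <= (2 * M%:R) ^+ 2 :> R.
Proof.
move=> M1; have -> : \sum_(0 <= k < M.+1) k.*2.+1%:R = M.+1%:R ^+ 2 :> R.
  elim: M.+1 => [|n IHn]; first by rewrite big_nil expr0n.
  by rewrite big_nat_recr //= IHn -muln2 -natr1 natrM -[in RHS]natr1; ring.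
by rewrite -natrM lerXn2r ?nnegrE ?ler0n // ler_nat mul2n -addnn -addn1 leq_add2l.
Qed.

Theorem theorem4p2 (R : realType) (beta : nat -> R) (phi : R -> R)
    (beta_gt0 : forall k, 0 < beta k)
    (beta_ndecr : forall k, (1 <= k)%N -> beta k <= beta k.+1)
    (phi_ge0 : forall t : R, 0 <= t -> 0 <= phi t)
    (phi_ndecr : {in `[0, +oo[ &, {homo phi : s t / s <= t}})
    (phi0 : phi 0 = 0)
    (phi_gt0 : forall t : R, 0 < t -> 0 < phi t)
    (ratio_monotone : ratio_nondecreasing phi \/ ratio_nonincreasing phi) :
  exists c : R, 0 < c /\
    forall (Y : harmonic_family R), harmonic_basis Y ->
    forall (M : nat), (1 <= M)%N ->
    forall (N : nat) (xs : 'I_N -> 'rV[R]_3) (w : 'I_N -> R),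
      (forall i, sphere (xs i)) -> (forall i, 0 < w i) ->
      quadrature_exact (2 * M) xs w ->
    forall (phihat : R -> R), is_phi_hat phi phihat ->
    forall (alpha : R), 0 < alpha ->
    forall (h : R -> R), filter_function h ->
    forall (y : 'rV[R]_3 -> R),
      {within sphere, continuous y} -> in_W phi beta Y y ->
      (sup_norm (T_zero Y M xs w (filtered_approx Y h M y)
                 \- T_reg Y beta alpha M xs w (filtered_approx Y h M y))%R
       <= (c * M%:R * phihat alpha * W_norm phi beta Y y)%:E)%E.
Proof.
(* The order of the [beta k] starts at [k = 1], so a common bound of all [beta k ^- 2] must include
   [beta 0] separately. *)
pose t0 := beta 0%N ^- 2 + beta 1%N ^- 2; pose K := 1 + phi t0 / t0.
have inv2_gt0 k : 0 < beta k ^- 2 by rewrite invr_gt0 exprn_gt0.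
have beta_t0 k : beta k ^- 2 <= t0.
  case: k => [|k]; first by rewrite lerDl ltW.
  apply: (@le_trans _ _ (beta 1%N ^- 2)); last by rewrite lerDr ltW.
  rewrite lef_pV2 ?posrE ?exprn_gt0 //.
  apply: lerXn2r; rewrite ?nnegrE ?(ltW (beta_gt0 _)) //.
  by elim: k => // k IHk; apply: le_trans IHk (beta_ndecr _ _).
have t0_gt0 : 0 < t0 by rewrite addr_gt0.
have K_gt0 : 0 < K by rewrite addr_gt0 // divr_gt0 ?phi_gt0.
(* The unit makes [c] positive before the area is known to be. *)
exists (1 + 2 * K / Num.sqrt area); split.
  by rewrite ltr_pwDl // mulr_ge0 ?invr_ge0 ?sqrtr_ge0 // mulr_ge0 // ltW.
move=> Y hY M M1 N xs w xsS _ quad phihat hat a a0 h [h01 _ _] y _ yW.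
have area0 := area_gt0 hY xsS quad.
have hat0 : 0 <= phihat a.
  by case: hat => -[_ ->] //; apply: ltW => //; apply: phi_gt0.
have W0 : 0 <= W_norm phi beta Y y by apply: sqrtr_ge0.
apply: ge_ereal_sup => _ [x xS <-]; rewrite lee_fin /= (T_zero_sub_T_reg hY quad) //.
apply: le_trans (cauchy_schwarz_dep_sum _ _ _) _.
have Ysum : Num.sqrt (\sum_(0 <= k < M.+1) \sum_j Y k j x ^+ 2) <=
    2 * M%:R / Num.sqrt area.
  under eq_big_nat => k kM do rewrite (addition_theorem hY xsS quad) //.
  rewrite -mulr_suml sqrtrM; last by apply: sumr_ge0.
  rewrite sqrtrV ?(ltW area0) //.
  apply: ler_wpM2r; first by rewrite invr_ge0 sqrtr_ge0.
  rewrite -[leRHS]ger0_norm ?mulr_ge0 // -sqrtr_sqr ler_wsqrtr //.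
  exact: sum_odd_le.
(* The filter value is at most 1, and the rest is the factor [a / (t + a)] at [t = beta k ^- 2]. *)
have factor k : 0 <= h (k%:R / M%:R) * (1 - (1 + a * beta k ^+ 2)^-1) <=
    K * phihat a / phi (beta k ^- 2).
  have /andP[h0 h1] : 0 <= h (k%:R / M%:R) <= 1 by rewrite h01 // divr_ge0.
  have -> : 1 - (1 + a * beta k ^+ 2)^-1 = a / (beta k ^- 2 + a).
    by field; rewrite ?gt_eqF // addr_gt0 ?mulr_gt0 ?exprn_gt0.
  have q0 : 0 <= a / (beta k ^- 2 + a) by rewrite divr_ge0 ?ltW ?addr_gt0.
  rewrite mulr_ge0 //=; apply: le_trans (ler_piMl q0 h1) _.
  by apply: filter_factor_le; rewrite ?inv2_gt0 ?beta_t0.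
have asum : Num.sqrt (\sum_(0 <= k < M.+1) \sum_j
      (h (k%:R / M%:R) * (1 - (1 + a * beta k ^+ 2)^-1) * inner (Y k j) y) ^+ 2)
    <= K * phihat a * W_norm phi beta Y y.
  have Kh0 : 0 <= K * phihat a by rewrite mulr_ge0 // ltW.
  apply: le_trans (ler_wpM2l Kh0 (W_norm_partial M.+1 yW)).
  rewrite -[X in _ <= X * _]ger0_norm // -sqrtr_sqr -sqrtrM ?sqr_ge0 //.
  rewrite ler_wsqrtr // mulr_sumr; apply: ler_sum => k _.
  rewrite mulr_sumr; apply: ler_sum => j _.
  have -> : (K * phihat a) ^+ 2 * (inner (Y k j) y / phi (beta k ^- 2)) ^+ 2 =
      (K * phihat a / phi (beta k ^- 2) * inner (Y k j) y) ^+ 2 by ring.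
  have /andP[m0 m_le] := factor k.
  rewrite ![(_ * inner (Y k j) y) ^+ 2]exprMn ler_wpM2r ?sqr_ge0 //.
  by rewrite lerXn2r ?nnegrE // (le_trans m0).
apply: le_trans (ler_pM _ _ Ysum asum) _; rewrite ?sqrtr_ge0 //.
(* The difference is exactly the contribution of the unit in [c]. *)
rewrite -subr_ge0 (_ : _ - _ = M%:R * phihat a * W_norm phi beta Y y).
  by rewrite !mulr_ge0.
by ring.
Qed.
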